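(* Every pretabular logic extending $\mathsf{S4BP}^{2,\omega}_{2,2}$ has the finite model property.
   Context: Tense formulas use $\Box$ and a past possibility operator written here $\mathsf{P}$; $\mathsf{S4}_t=\mathsf{K}_t\oplus\{\Box p\to p,\Box p\to\Box\Box p\}$. $\mathsf{S4BP}^{2,\omega}_{2,2}$ is $\mathsf{S4}_t$ extended by axioms bounding depth by 2, forth-width by 2 and back-width by 2 (with $\mathbf{bd}_1=\Diamond\Box p_0\to p_0$, $\mathbf{bd}_2=\Diamond(\Box p_1\wedge\neg\mathbf{bd}_1)\to p_1$, $\mathbf{bw}^+_2=\bigwedge_{i\leq2}\Diamond p_i\to\bigvee_{i\neq j\leq2}\Diamond(p_i\wedge(p_j\vee\Diamond p_j))$, and $\mathbf{bw}^-_2$ the same with $\mathsf{P}$ for $\Diamond$). A logic is pretabular if it is not the logic of a finite frame but all its consistent proper extensions are; it has the finite model property if it is the logic of a class of finite frames. *)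

(* Defs.v *)
From mathcomp Require Import all_boot.
From mathcomp Require Import boolp classical_sets cardinality.

Set Implicit Arguments.
Unset Strict Implicit.
Unset Printing Implicit Defensive.

Local Open Scope classical_set_scope.

Inductive form : Type :=
  | Var of nat
  | Bot
  | Imp of form & form
  | Box of form
  | Past of form. (* "at some predecessor": the operator P *)

Declare Scope tense_scope.
Delimit Scope tense_scope with T.
Bind Scope tense_scope with form.

Definition Neg p := Imp p Bot.
Definition Top := Neg Bot.
Definition Or p q := Imp (Neg p) q.
Definition And p q := Neg (Imp p (Neg q)).
Definition Dia p := Neg (Box (Neg p)).

Notation "~~ p" := (Neg p) : tense_scope.
Notation "p ==> q" := (Imp p q) : tense_scope.
Notation "p && q" := (And p q) : tense_scope.
Notation "p || q" := (Or p q) : tense_scope.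

Fixpoint subst (s : nat -> form) (p : form) : form :=
  match p with
  | Var n => s n
  | Bot => Bot
  | Imp p q => Imp (subst s p) (subst s q)
  | Box p => Box (subst s p)
  | Past p => Past (subst s p)
  end.

(* Formulas whose main connective is modal are treated as atoms, so that
   [taut] holds of all substitution instances of classical tautologies. *)
Fixpoint prop_eval (v : form -> bool) (p : form) : bool :=
  match p with
  | Bot => false
  | Imp p q => prop_eval v p ==> prop_eval v q
  | _ => v p
  end.

Definition taut : set form := [set p | forall v, prop_eval v p].

(* Residuation [tl_adj], with tautologies and modus ponens, amounts to the
   usual axioms: it gives K and necessitation for Box and for the dual of
   Past, congruence for Past, p -> Box (Past p) and Past (Box p) -> p. *)
Record tense_logic (L : set form) : Prop := TenseLogic {
  tl_taut : taut `<=` L;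
  tl_adj p q : L (Past p ==> q)%T <-> L (p ==> Box q)%T;
  tl_mp p q : L (p ==> q)%T -> L p -> L q;
  tl_subst s p : L p -> L (subst s p) }.

Definition oplus (L A : set form) : set form := smallest tense_logic (L `|` A).

Definition Kt : set form := smallest tense_logic set0.

Definition S4t : set form :=
  oplus Kt [set (Box (Var 0) ==> Var 0)%T;
                (Box (Var 0) ==> Box (Box (Var 0)))%T].

Definition bd1 : form := (Dia (Box (Var 0)) ==> Var 0)%T.
Definition bd2 : form := (Dia (Box (Var 1) && ~~ bd1) ==> Var 1)%T.

(* Width formula for an arbitrary possibility operator [m]; both indices
   range over 0, ..., n, so [bw m 2] has three variables. *)
Definition bw (m : form -> form) (n : nat) : form :=
  (\big[And/Top]_(0 <= i < n.+1) m (Var i) ==>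
   \big[Or/Bot]_(0 <= i < n.+1) \big[Or/Bot]_(0 <= j < n.+1 | i != j)
     m (Var i && (Var j || m (Var j))))%T.

Definition S4BP2w22 : set form :=
  oplus S4t [set bd2; bw Dia 2; bw Past 2].

Record frame : Type := Frame {
  world :> Type;
  acc : world -> world -> Prop;
  world_nonempty : [set: world] !=set0 }.

Fixpoint sat (F : frame) (V : nat -> set F) (x : F) (p : form) : Prop :=
  match p with
  | Var n => V n x
  | Bot => False
  | Imp p q => sat V x p -> sat V x q
  | Box p => forall y, acc x y -> sat V y p
  | Past p => exists2 y, acc y x & sat V y p
  end.

Definition valid (F : frame) (p : form) : Prop :=
  forall (V : nat -> set F) (x : F), sat V x p.

Definition Log (K : set frame) : set form :=
  [set p | forall F, K F -> valid F p].

Definition finite_frame : set frame := [set F | finite_set [set: F]].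

Definition consistent (L : set form) : Prop := ~ L Bot.

Definition tabular (L : set form) : Prop :=
  exists2 F, finite_frame F & L = Log [set F].

Definition pretabular (L : set form) : Prop :=
  [/\ tense_logic L, ~ tabular L &
    forall L', tense_logic L' -> L `<` L' -> consistent L' -> tabular L'].

Definition fmp (L : set form) : Prop :=
  exists2 K, K `<=` finite_frame & L = Log K.

(* Main.v *)
(* Work in the canonical model of L, whose points are the maximal L-theories.
   The axioms make it a preorder of depth 2 in which a point has, up to
   clusters, at most two strict successors and two strict predecessors, so a
   component is a path or a cycle of clusters, alternately going up and down;
   moreover on finitely many clusters every union of clusters is cut out by a
   formula.  Let [step p] say that p holds somewhere one step up or down.
   If L proves step^{k+1} p -> step^k p for some k, components consist of
   finitely many clusters, and identifying the points of a cluster which agree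
   on the variables of a formula phi gives a finite L-frame refuting phi
   whenever phi is not in L.
   Otherwise the canonical model has geodesics of any length, whose interior is
   locally an infinite fence; mapping it modulo 2n to a fence closed into a
   cycle shows that every finite cycle validates L.  The logic of these cycles
   is consistent and not tabular, so by pretabularity it is L. *)
Require Import Defs.
From HB Require Import structures.
From mathcomp Require Import all_boot zify.
From mathcomp Require Import boolp classical_sets cardinality.

Set Implicit Arguments.
Unset Strict Implicit.
Unset Printing Implicit Defensive.

Local Open Scope classical_set_scope.

(** * Soundness of the frame semantics *)

Lemma tense_logic_Log (K : set frame) : tense_logic (Log K).
Proof.
split=> [p tp F _ V x|p q|p q Lpq Lp F KF V x|s p Lp F KF V x].
(* Giving each modal atom its truth value at [x] turns satisfaction into propositional
   evaluation. *)
- have e q : `[<sat V x q>] = prop_eval (fun r => `[<sat V x r>]) q.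
    elim: q => //= [|q IHq r IHr]; first exact: asboolF.
    rewrite -IHq -IHr; apply/asboolP/implyP => h /asboolP => [/h/asboolP|/h] //.
    by move/asboolP.
  by apply/asboolP; rewrite e; apply: tp.
- split=> Lpq F KF V x /=; first by move=> px y xy; apply: (Lpq F KF); exists x.
  by case=> y yx py; apply: (Lpq F KF V y).
- by apply: (Lpq F KF); apply: (Lp F KF).
- have e q y : sat V y (subst s q) <-> sat (fun n => [set z | sat V z (s n)]) y q.
    elim: q y => //= [q IHq r IHr|q IHq|q IHq] y.
    + by rewrite (propext (IHq y)) (propext (IHr y)).
    + by split=> h z yz; apply/IHq/h.
    + by split=> -[z zy /IHq hz]; exists z.
  exact/e/(Lp F KF).
Qed.

(** * Walks along a relation and its converse *)

Section Walks.
Variables (T : Type) (R : T -> T -> Prop).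

Definition link x y := R x y \/ R y x.

Fixpoint walk n x y :=
  if n is m.+1 then exists2 z, link x z & walk m z y else x = y.

Lemma link_sym x y : link x y -> link y x.
Proof. by case; [right|left]. Qed.

Lemma walk_cat m n x y z : walk m x y -> walk n y z -> walk (m + n) x z.
Proof.
elim: m x => [|m IH] x /=; first by move=> ->.
by move=> [u xu uy] yz; exists u => //; apply: IH.
Qed.

Lemma walk1 x y : link x y -> walk 1 x y.
Proof. by exists y. Qed.

Lemma walkSr n x y : walk n.+1 x y -> exists2 z, walk n x z & link z y.
Proof.
elim: n x => [|n IH] x /=; first by move=> [z xz <-]; exists x.
by move=> [u xu /IH[z uz zy]]; exists z => //; exists u.
Qed.

Lemma walk_path n x y : walk n x y ->
  exists f : nat -> T, [/\ f 0 = x, f n = y & forall i, i < n -> link (f i) (f i.+1)].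
Proof.
elim: n x => [|n IH] x /=; first by move=> ->; exists (fun=> y).
move=> [z xz /IH[f [f0 fn fE]]]; exists (fun i => if i is j.+1 then f j else x).
by split=> // -[_|i /fE//]; rewrite f0.
Qed.

Lemma path_walk (f : nat -> T) i n : (forall j, i <= j < i + n -> link (f j) (f j.+1)) ->
  walk n (f i) (f (i + n)).
Proof.
elim: n i => [|n IH] i fE; first by rewrite addn0.
exists (f i.+1); first by apply: fE; rewrite leqnn addnS ltnS leq_addr.
rewrite addnS -addSn; apply: IH => j /andP[ij jn]; apply: fE.
by rewrite addnS -addSn jn ltnW.
Qed.

Hypothesis Rrefl : forall x, R x x.

Lemma walk_refl n x : walk n x x.
Proof. by elim: n => //= n IH; exists x => //; left. Qed.

Lemma walk_leq m n x y : m <= n -> walk m x y -> walk n x y.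
Proof. by move=> /subnKC <- xy; apply: walk_cat xy (walk_refl _ _). Qed.

End Walks.

Definition step p := Or (Dia p) (Past p).

Lemma subst_iter_step s n p : subst s (iter n step p) = iter n step (subst s p).
Proof. by elim: n => //= n ->. Qed.

Lemma sat_iter_step (F : frame) (V : nat -> set F) n x p :
  sat V x (iter n step p) <-> exists2 y, walk (@acc F) n x y & sat V y p.
Proof.
elim: n x => [|n IH] x /=.
  by split=> [h|[y ->]//]; exists x.
split=> [h|[y [z xz zy] py] h].
  case: (pselect (exists2 y, acc y x & sat V y (iter n step p))) =>
      [[y yx /IH[z yz pz]]|nP].
    by exists z => //; exists y => //; right.
  apply: contrapT => nx; apply: nP; apply: h; apply => y xy /IH[z yz pz].
  by apply: nx; exists z => //; exists y => //; left.
case: xz => [xz|zx]; last by exists z => //; apply/IH; exists y.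
by exfalso; apply: h => nz; apply: (nz z xz); apply/IH; exists y.
Qed.

(** * The canonical model *)

Definition theory (L T : set form) :=
  L `<=` T /\ forall p q, T (Imp p q) -> T p -> T q.

Record ultra (L : set form) := Ultra {
  holds :> form -> Prop;
  ultra_theory : theory L holds;
  ultra_Bot : ~ holds Bot;
  ultra_total : forall p, holds p \/ holds (Neg p) }.

(** A classical equality test, so that lists of points have a membership predicate. *)
HB.instance Definition _ (L : set form) := gen_eqMixin (ultra L).

Ltac tautology := let v := fresh "v" in
  move=> v; rewrite /And /Or /Neg /=;
  repeat match goal with |- context [prop_eval v ?p] => case: (prop_eval v p) end;
  done.

Section Canonical.
Variable L : set form.
Hypothesis tL : tense_logic L.

Lemma theory_taut T p : theory L T -> taut p -> T p.
Proof. by move=> [LT _] tp; apply/LT/(tl_taut tL). Qed.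

(** Deduction theorem: this set is the theory generated by [T] and [p]. *)
Lemma theory_adjoin T p : theory L T -> theory L [set q | T (Imp p q)].
Proof.
move=> TT; have [LT Tmp] := TT; split=> [q Lq|q r /= Tpqr Tpq].
  by apply: (Tmp _ _ _ (LT _ Lq)); apply: theory_taut => //; tautology.
apply: (Tmp _ _ (Tmp _ _ _ Tpqr) Tpq); apply: theory_taut => //; tautology.
Qed.

(** Lindenbaum's lemma, by Zorn. *)
Lemma theory_ultra T : theory L T -> ~ T Bot -> exists x : ultra L, T `<=` holds x.
Proof.
move=> TT TB.
(* The condition is put on the union of [T] and [A], so that the empty chain, whose union is empty,
   is no exception. *)
pose P A := theory L (T `|` A) /\ ~ (T `|` A) Bot.
have [F FP Ftot|A [[TA AB] Amax]] := @Zorn_bigcup _ P.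
  split; last by case=> // -[X /FP[_ XB] XBot]; apply: XB; right.
  split=> [p Lp|p q]; first by left; apply: TT.1.
  have mono X Y : X `<=` Y -> T `|` X `<=` T `|` Y by move=> h; apply: setUS.
  have up X : F X -> T `|` X `<=` T `|` \bigcup_(X in F) X.
    by move=> FX; apply: mono => r Xr; exists X.
  move=> [Tpq|[X FX Xpq]] [Tp|[Y FY Yp]].
  - by left; apply: TT.2 Tp.
  - by apply: (up _ FY); apply: (FP _ FY).1.2; [left; apply: Tpq|right].
  - by apply: (up _ FX); apply: (FP _ FX).1.2; [right; apply: Xpq|left].
  - have [XY|YX] := Ftot _ _ FX FY.
      by apply: (up _ FY); apply: (FP _ FY).1.2; [right; apply/XY/Xpq|right].
    by apply: (up _ FX); apply: (FP _ FX).1.2; [right; apply: Xpq|right; apply: YX].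
have tot p : (T `|` A) p \/ (T `|` A) (Neg p).
  apply: contrapT => /not_orP[np nnp].
  have Tp := theory_adjoin p TA; have sub : T `|` A `<=` [set q | (T `|` A) (Imp p q)].
    move=> q Aq; apply: (TA.2 _ _ _ Aq); apply: theory_taut => //; tautology.
  apply: (Amax [set q | (T `|` A) (Imp p q)]); last first.
    by rewrite /P setUidr // => q Tq; apply: sub; left.
  split; first by move=> q Aq; apply: sub; right.
  move=> /(_ p) h; apply: np; right; apply: h; apply: (theory_taut TA).
  by tautology.
by exists (Ultra TA AB tot) => p Tp; left.
Qed.

Lemma theory_separation T p : theory L T -> ~ T p ->
  exists2 x : ultra L, T `<=` holds x & ~ x p.
Proof.
move=> TT Tp; have [|x Tx] := theory_ultra (theory_adjoin (Neg p) TT).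
  move=> /= h; apply: Tp; apply: TT.2 h; apply: theory_taut => //; tautology.
exists x => [q Tq|xp].
  by apply: Tx => /=; apply: (TT.2 q) Tq; apply: theory_taut => //; tautology.
apply: (@ultra_Bot _ x); apply: (ultra_theory x).2 xp.
by apply: Tx => /=; apply: theory_taut => //; tautology.
Qed.

Implicit Types x y z : ultra L.

Lemma holds_L x p : L p -> x p.
Proof. exact: (ultra_theory x).1. Qed.

Lemma holdsN x p : x (Neg p) <-> ~ x p.
Proof.
split=> [xn xp|]; first by apply: (@ultra_Bot _ x); apply: (ultra_theory x).2 xp.
by have [] := ultra_total x p.
Qed.

Lemma holdsI x p q : x (Imp p q) <-> (x p -> x q).
Proof.
split; first exact: (ultra_theory x).2.
move=> h; have [xp|/holdsN xp] := pselect (x p).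
  apply: (ultra_theory x).2 (h xp); apply: (theory_taut (ultra_theory x)); tautology.
apply: (ultra_theory x).2 xp; apply: (theory_taut (ultra_theory x)); tautology.
Qed.

Lemma holdsB x : x Bot <-> False.
Proof. by split=> // /(@ultra_Bot _ x). Qed.

Lemma holdsA x p q : x (And p q) <-> x p /\ x q.
Proof.
rewrite /And holdsN holdsI holdsN; split=> [h|[xp xq]]; last by apply.
by split; apply: contrapT => n; apply: h => ?.
Qed.

Lemma holdsO x p q : x (Or p q) <-> x p \/ x q.
Proof.
rewrite /Or holdsI holdsN; split=> [h|[]//].
by have [xp|/h] := pselect (x p); [left|right].
Qed.

Lemma ultra_complete p : L p <-> forall x, x p.
Proof.
split=> [Lp x|h]; first exact: holds_L.
apply: contrapT => nL; have LL : theory L L by split=> // q r; apply: tl_mp.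
by have [x _] := theory_separation LL nL; apply.
Qed.

Definition can x y := forall p, x (Box p) -> y p.

(** By completeness, provable implication is implication at all points, so residuation may be used
    pointwise; the modal laws below are consequences of this adjunction. *)
Lemma ultra_adj p q : (forall x, x (Past p) -> x q) <-> forall x, x p -> x (Box q).
Proof.
have e r s : L (Imp r s) <-> forall x, x r -> x s.
  by rewrite ultra_complete; split=> h x; move: (h x); rewrite holdsI.
by rewrite -!e; apply: tl_adj.
Qed.

Lemma Box_mono p q : (forall x, x p -> x q) -> forall x, x (Box p) -> x (Box q).
Proof.
move=> pq; apply/ultra_adj => x h; apply: pq.
by move: x h; apply/ultra_adj.
Qed.

Lemma Past_mono p q : (forall x, x p -> x q) -> forall x, x (Past p) -> x (Past q).
Proof.
move=> pq; apply/ultra_adj => x /pq.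
by move: x; apply/ultra_adj.
Qed.

Lemma Past_Box p x : x (Past (Box p)) -> x p.
Proof. by move: x; apply/ultra_adj. Qed.

Lemma Box_Past p x : x p -> x (Box (Past p)).
Proof. by move: x; apply/ultra_adj. Qed.

Lemma PastB x : ~ x (Past Bot).
Proof. by move=> h; apply/(holdsB x); move: x h; apply/ultra_adj => x /holdsB. Qed.

Lemma Past_or p q x : x (Past (Or p q)) -> x (Past p) \/ x (Past q).
Proof.
rewrite -holdsO; move: x; apply/ultra_adj => x /holdsO[] h.
  by move: (Box_Past h); apply: Box_mono => y h'; apply/holdsO; left.
by move: (Box_Past h); apply: Box_mono => y h'; apply/holdsO; right.
Qed.

Lemma Box_and p q x : x (Box p) -> x (Box q) -> x (Box (And p q)).
Proof.
move=> xp xq; have: x (And (Box p) (Box q)) by apply/holdsA.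
move: x {xp xq}; apply/ultra_adj => x h; apply/holdsA.
by split; apply: Past_Box; apply: Past_mono h => y /holdsA[].
Qed.

Lemma Box_nec p x : (forall x, x p) -> x (Box p).
Proof.
move=> h; have: x Top by apply/holdsN/ultra_Bot.
by move: x; apply/ultra_adj.
Qed.

Lemma holds_Box x p : x (Box p) <-> forall y, can x y -> y p.
Proof.
split=> [xp y xy|h]; first exact: xy.
apply: contrapT => nx; have TT : theory L [set q | x (Box q)].
  split=> [q /ultra_complete Lq /=|q r /= xqr xq]; first exact: Box_nec.
  move: (Box_and xqr xq); apply: Box_mono => y /holdsA[].
  by rewrite holdsI.
by have [y xy] := theory_separation TT nx; apply; apply: h => q /xy.
Qed.

Lemma holds_Past x p : x (Past p) <-> exists2 y, can y x & y p.
Proof.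
split=> [xp|[y yx yp]]; last exact/yx/Box_Past.
(* These are the formulas that, as far as [x] can tell, hold at every predecessor satisfying [p]; a
   maximal extension is the predecessor sought. *)
pose T := [set q | ~ x (Past (And p (Neg q)))].
have TT : theory L T.
  split=> [q Lq /= xq|q r Tqr Tq /=].
    apply: (@PastB x); apply: Past_mono xq => y /holdsA[_ /holdsN]; case.
    exact: holds_L.
  move=> h; have: x (Past (Or (And p (Neg (Imp q r))) (And p (Neg q)))).
    apply: Past_mono h => y; rewrite holdsO !holdsA !holdsN holdsI => -[yp nr].
    by have [yq|nq] := pselect (y q); [left|right]; split=> // /(_ yq).
  by case/Past_or; [apply: Tqr|apply: Tq].
have [|y Ty] := theory_ultra TT.
  by rewrite /T /=; apply; apply: Past_mono xp => y yp; rewrite holdsA holdsN holdsB; split.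
(* Every formula of [y] occurs with [p] in the past of [x], so by [Past_Box] what is boxed at [y]
   holds at [x]. *)
have yT q : y q -> x (Past (And p q)).
  move=> yq; apply: contrapT => nx; have : y (Neg q).
    apply: Ty => /= h; apply: nx; apply: Past_mono h => z.
    by rewrite !holdsA !holdsN => -[? nn]; split=> //; apply: contrapT.
  by rewrite holdsN.
exists y.
  move=> q /yT h; apply: Past_Box; apply: Past_mono h => z; by rewrite holdsA => -[].
apply: Ty => /= h; apply: (@PastB x); apply: Past_mono h => z.
by rewrite holdsA holdsN => -[].
Qed.

Lemma holds_Dia x p : x (Dia p) <-> exists2 y, can x y & y p.
Proof.
rewrite /Dia holdsN holds_Box; split=> [h|[y xy yp] h].
  by apply: contrapT => n; apply: h => y xy; rewrite holdsN => yp; apply: n; exists y.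
by have := h y xy; rewrite holdsN.
Qed.

Lemma holds_iter_step n x p :
  x (iter n step p) <-> exists2 y, walk can n x y & y p.
Proof.
elim: n x => [|n IH] x /=; first by split=> [h|[y ->]//]; exists x.
rewrite /step holdsO holds_Dia holds_Past; split.
  case=> -[y xy /IH[z yz pz]]; exists z => //; exists y => //; [by left|by right].
move=> [y [z [xz|zx] zy] py]; [left|right]; exists z => //; apply/IH; by exists y.
Qed.

Lemma holds_bigAnd x (I : eqType) (r : seq I) (P : pred I) (F : I -> form) :
  x (\big[And/Top]_(i <- r | P i) F i) <-> forall i, i \in r -> P i -> x (F i).
Proof.
elim: r => [|a r IH]; first by rewrite big_nil; split=> // _; apply/holdsN/ultra_Bot.
rewrite big_cons; split.
  case: ifP => [Pa /holdsA[xa /IH h] i|Pa /IH h i].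
    by rewrite inE => /orP[/eqP -> //|/h]; apply.
  by rewrite inE => /orP[/eqP ->|/h//]; rewrite Pa.
move=> h; have hr : x (\big[And/Top]_(i <- r | P i) F i).
  by apply/IH => i ir; apply: h; rewrite inE ir orbT.
by case: ifP => // Pa; apply/holdsA; split=> //; apply: h; rewrite ?inE ?eqxx.
Qed.

Lemma holds_bigOr x (I : eqType) (r : seq I) (P : pred I) (F : I -> form) :
  x (\big[Or/Bot]_(i <- r | P i) F i) <-> exists i, [/\ i \in r, P i & x (F i)].
Proof.
elim: r => [|a r IH]; first by rewrite big_nil holdsB; split=> // -[i []].
rewrite big_cons; split.
  case: ifP => [Pa /holdsO[xa|/IH[i [ir Pi xi]]]|Pa /IH[i [ir Pi xi]]].
  - by exists a; rewrite inE eqxx.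
  - by exists i; rewrite inE ir orbT.
  - by exists i; rewrite inE ir orbT.
move=> [i [+ Pi xi]]; rewrite inE => /orP[/eqP e|ir].
  by rewrite -e Pi; apply/holdsO; left.
have: x (\big[Or/Bot]_(i <- r | P i) F i) by apply/IH; exists i.
by case: ifP => // _ h; apply/holdsO; right.
Qed.

End Canonical.

(** * Preorders of depth and width two *)

Section Depth2.
Variables (T : Type) (R : T -> T -> Prop).

Definition clus x y := R x y /\ R y x.

(** Depth two and no three pairwise incomparable successors; the bound on predecessors is this
    condition for the converse relation. *)
Record narrow : Prop := Narrow {
  nrefl : forall x, R x x;
  ntrans : forall x y z, R x y -> R y z -> R x z;
  ndepth : forall x y z, R x y -> R y z -> R y x \/ R z y;
  nwidth : forall x (y : nat -> T), (forall i, i < 3 -> R x (y i)) ->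
    exists i j, [/\ i < 3, j < 3, i <> j & R (y i) (y j)] }.

Hypothesis nR : narrow.

Lemma clus_sym x y : clus x y -> clus y x.
Proof. by case. Qed.

Lemma clus_trans x y z : clus x y -> clus y z -> clus x z.
Proof. by move=> [xy yx] [yz zy]; split; apply: (ntrans nR); eauto. Qed.

(** By width, two of [z], [b], [c] are comparable. Unless [z] is in the cluster of [x], all three
    are strictly above [x], where by depth comparable points share a cluster; [b] and [c] do not. *)
Lemma narrow_up x b c z : R x b -> ~ R b x -> R x c -> ~ R c x -> ~ clus b c ->
  R x z -> clus z x \/ clus z b \/ clus z c.
Proof.
move=> xb bx xc cx bc xz.
have [zx|zx] := pselect (R z x); first by left.
right; pose y i := if i is 0 then z else if i is 1 then b else c.
have [|i [j [i3 j3 ij yij]]] := nwidth nR (x := x) (y := y); first by case=> [|[|]].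
have xy k : R x (y k) by case: k => [|[|]].
have nyx k : ~ R (y k) x by case: k => [|[|]].
have {yij} yc : clus (y i) (y j).
  by split=> //; have [/nyx|] := ndepth nR (xy i) yij.
have cy := clus_sym yc.
by case: i j i3 j3 ij yc cy => [|[|[|?]]] [|[|[|?]]] //= _ _ _ yc cy;
  [left|right|left|right].
Qed.

Lemma narrow_down x b z : R x b -> ~ R b x -> R z x -> clus z x.
Proof. by move=> xb bx zx; split=> //; have [|/bx] := ndepth nR zx xb. Qed.

Lemma narrow_cover_up x : exists s : seq T,
  forall z, R x z -> exists i, i < size s /\ clus z (nth x s i).
Proof.
have [[b [xb bx]]|nb] := pselect (exists b, R x b /\ ~ R b x); last first.
  exists [:: x] => z xz; exists 0; split=> //; split=> //=.
  by apply: contrapT => zx; apply: nb; exists z.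
have [[c [xc cx bc]]|nc] := pselect (exists c, [/\ R x c, ~ R c x & ~ clus b c]).
  exists [:: x; b; c] => z /(narrow_up xb bx xc cx bc) [|[]].
  - by exists 0.
  - by exists 1.
  - by exists 2.
exists [:: x; b] => z xz.
have [zx|zx] := pselect (R z x); first by exists 0.
exists 1; split=> //=; apply: clus_sym; apply: contrapT => bz.
by apply: nc; exists z.
Qed.

End Depth2.

(** * Definable sets of the canonical model *)

Section Definability.
Variables (L : set form) (tL : tense_logic L) (hext : S4BP2w22 `<=` L).
Implicit Types x y z u v w : ultra L.

Lemma S4t_sub : S4t `<=` L.
Proof. by move=> p Sp; apply: hext; apply: sub_gen_smallest; left. Qed.

Lemma holds_subst x s p : L p -> x (subst s p).
Proof. by move=> Lp; apply/(holds_L x)/(tl_subst tL). Qed.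

Lemma holds_T x p : x (Box p) -> x p.
Proof.
apply/(holdsI tL)/(@holds_subst x (fun=> p) (Imp (Box (Var 0)) (Var 0))).
by apply: S4t_sub; apply: sub_gen_smallest; right; left.
Qed.

Lemma holds_4 x p : x (Box p) -> x (Box (Box p)).
Proof.
apply/(holdsI tL)/(@holds_subst x (fun=> p) (Imp (Box (Var 0)) (Box (Box (Var 0))))).
by apply: S4t_sub; apply: sub_gen_smallest; right; right.
Qed.

Lemma can_refl x : can x x.
Proof. by move=> p /holds_T. Qed.

Lemma can_trans x y z : can x y -> can y z -> can x z.
Proof. by move=> xy yz p /holds_4/xy/yz. Qed.

Lemma not_can x y : ~ can x y -> exists2 p, x (Box p) & ~ y p.
Proof.
move=> xy; apply: contrapT => n; apply: xy => p xp.
by apply: contrapT => yp; apply: n; exists p.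
Qed.

Lemma can_depth x y z : can x y -> can y z -> can y x \/ can z y.
Proof.
(* [bd2] is instantiated by [a] and [b]: at [y], [Box b] holds and [bd1] fails because of [z], so
   [x] would satisfy [b]. *)
move=> xy yz; apply: contrapT => /not_orP[/not_can[b yb xb] /not_can[a za ya]].
apply: xb; have : x (subst (fun n => if n is 0 then a else b) bd2).
  by apply: holds_subst; apply: hext; apply: sub_gen_smallest; right; left; left.
move/(holdsI tL); apply; apply/(holds_Dia tL); exists y => //.
apply/(holdsA tL); split=> //; apply/holdsN => /(holdsI tL) h.
by apply: ya; apply: h; apply/(holds_Dia tL); exists z.
Qed.

(** [m] stands for [Dia] or [Past] and [S] for the relation it looks along, so that one argument
    serves both width axioms. *)
Lemma can_width (m : form -> form) (S : ultra L -> ultra L -> Prop) :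
  (forall s p, subst s (m p) = m (subst s p)) ->
  (forall x p, x (m p) <-> exists2 y, S x y & y p) ->
  (forall x y, S x y -> can x y \/ can y x) -> L (bw m 2) ->
  forall x (y : nat -> ultra L), (forall i, i < 3 -> S x (y i)) ->
    exists i j, [/\ i < 3, j < 3, i <> j & can (y i) (y j)].
Proof.
move=> msubst mE Scan Lbw x y xy; apply: contrapT => nij.
have /choice[a aP] : forall ij : nat * nat, exists a,
    [/\ ij.1 < 3, ij.2 < 3 & ij.1 <> ij.2] -> y ij.1 (Box a) /\ ~ y ij.2 a.
  move=> [i j] /=; have [h|h] := pselect ([/\ i < 3, j < 3 & i <> j]); last by exists Bot.
  have [|p] := @not_can (y i) (y j); last by exists p.
  by case: h => i3 j3 ij h; apply: nij; exists i, j.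
(* [a (i, j)] witnesses that [y i] does not see [y j]. Hence [p i] holds at [y i], while no point of
   [p i] sees one of [p j]; yet the width axiom yields such points, equal or comparable. *)
pose p (i : nat) := \big[And/Top]_(0 <= j < 3 | j != i) And (Box (a (i, j))) (Neg (a (j, i))).
have yp i : i < 3 -> y i (p i).
  move=> i3; apply/(holds_bigAnd tL) => j; rewrite mem_index_iota => j3 /eqP ji.
  apply/(holdsA tL); split; first by have [] // := aP (i, j); split=> // e; apply: ji.
  by apply/holdsN; have [] // := aP (j, i).
have sep i j u v : i < 3 -> j < 3 -> i <> j -> u (p i) -> v (p j) -> ~ can u v.
  move=> i3 j3 ij ui vj uv.
  have /(holdsA tL)[+ _] : u (And (Box (a (i, j))) (Neg (a (j, i)))).
    move: ui => /(holds_bigAnd tL) /(_ j); apply; rewrite ?mem_index_iota //.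
    by apply/eqP => e; apply: ij.
  have /(holdsA tL)[_ /holdsN] : v (And (Box (a (j, i))) (Neg (a (i, j)))).
    move: vj => /(holds_bigAnd tL) /(_ i); apply; rewrite ?mem_index_iota //.
    exact/eqP.
  by move=> h /uv.
have := holds_subst x p Lbw.
rewrite /bw /= (big_morph (subst p) (op1 := And) (id1 := Top)) //.
rewrite (big_morph (subst p) (op1 := Or) (id1 := Bot)) //.
rewrite (holdsI tL) (holds_bigAnd tL) (holds_bigOr tL) => -[i|i [+ _]];
  rewrite mem_index_iota => i3.
  by rewrite msubst => _; apply/mE; exists (y i); [apply: xy|apply: yp].
rewrite (big_morph (subst p) (op1 := Or) (id1 := Bot)) //.
move=> /(holds_bigOr tL)[j []]; rewrite mem_index_iota => j3 /eqP ij.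
rewrite msubst /= => /mE[u xu] /(holdsA tL)[ui /(holdsO tL)[uj|]].
  exact: (sep i j u u) (@can_refl u).
rewrite msubst => /mE[v uv vj].
have [cuv|cvu] := Scan _ _ uv; first exact: (sep i j u v).
by apply: (sep j i v u) cvu => // e; apply: ij.
Qed.

Lemma narrow_can : narrow (@can L).
Proof.
split; [exact: can_refl|exact: can_trans|exact: can_depth|].
apply: (@can_width Dia (@can L)) => //; first exact: holds_Dia.
  by left.
by apply: hext; apply: sub_gen_smallest; right; left; right.
Qed.

Lemma narrow_nac : narrow (fun x y => @can L y x).
Proof.
split; [exact: can_refl| |by move=> x y z yx zy; apply/or_comm; exact: can_depth zy yx|].
  by move=> x y z yx zy; apply: can_trans yx.
move=> x y xy; have [||||j [i [j3 i3 ij]]] :=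
    @can_width Past (fun x y => @can L y x) _ _ _ _ x y xy => //.
- exact: holds_Past.
- by right.
- by apply: hext; apply: sub_gen_smallest; right; right.
by exists i, j; split=> // e; apply: ij.
Qed.

Let E := link (@can L).

Lemma link_clus x y z : E x y -> clus (@can L) y z -> E x z.
Proof.
by move=> [xy|yx] [yz zy]; [left|right]; apply: can_trans; eauto.
Qed.

(** By transitivity a boxed formula is constant on a cluster, so separating formulas are taken boxed
    or negated boxed. *)
Lemma clus_separation x y : ~ clus (@can L) x y ->
  exists p, (forall z, clus (@can L) z x -> z p) /\ (forall z, clus (@can L) z y -> ~ z p).
Proof.
move=> /not_andP[] /not_can[p hp np].
  exists (Box p); split=> z [h1 h2]; first exact/h2/holds_4.
  by move=> /h1.
exists (Neg (Box p)); split=> z [h1 h2]; rewrite holdsN; first by move=> /h1.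
by apply; exact/h2/holds_4.
Qed.

Lemma clus_isolation (s : seq (ultra L)) x : exists p,
  (forall z, clus (@can L) z x -> z p) /\
  (forall y z, y \in s -> ~ clus (@can L) x y -> clus (@can L) z y -> ~ z p).
Proof.
elim: s => [|y s [p [xp sp]]].
  by exists Top; split=> // z _; apply/holdsN/ultra_Bot.
have [xy|/clus_separation[q [xq yq]]] := pselect (clus (@can L) x y).
  by exists p; split=> // y' z; rewrite inE => /orP[/eqP -> //|]; apply: sp.
exists (And q p); split=> [z zx|y' z]; first by apply/(holdsA tL); split; auto.
rewrite inE => /orP[/eqP -> _ /yq|ys xy' zy']; first by rewrite (holdsA tL) => h [].
by rewrite (holdsA tL) => -[_]; apply: sp ys xy' zy'.
Qed.

Definition around (s : seq (ultra L)) : set (ultra L) :=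
  [set z | exists2 y, y \in s & clus (@can L) z y].

Definition definable (D S : set (ultra L)) :=
  exists p, forall z, D z -> (z p <-> S z).

(** The formula is the disjunction, over the listed points in [S], of formulas isolating their
    clusters within the list. *)
Lemma clus_definable s (S : set (ultra L)) :
  (forall x y, clus (@can L) x y -> S x -> S y) -> definable (around s) S.
Proof.
move=> Sinv; have /choice[p pP] := clus_isolation s.
exists (\big[Or/Bot]_(y <- s | `[<S y>]) p y) => z [y ys zy].
rewrite (holds_bigOr tL); split=> [[u [us /asboolP Su zu]]|Sz]; last first.
  by exists y; rewrite ys; split=> //; [apply/asboolP/(Sinv z)|apply: (pP y).1].
have [uy|uy] := pselect (clus (@can L) u y); last by case: ((pP u).2 y z).
by apply: Sinv Su; apply: clus_trans uy (clus_sym zy); exact: narrow_can.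
Qed.

Lemma link_cover x : exists s, [set y | E x y] `<=` around s.
Proof.
have [s sP] := narrow_cover_up narrow_can x.
have [t tP] := narrow_cover_up narrow_nac x.
exists (s ++ t) => y [/sP|/tP] [i [ilt c]].
  by exists (nth x s i); rewrite ?mem_cat ?mem_nth.
by exists (nth x t i); rewrite ?mem_cat ?mem_nth ?orbT //; case: c.
Qed.

Lemma walk_cover n x : exists s, [set y | walk (@can L) n x y] `<=` around s.
Proof.
elim: n => [|n [s sP]].
  by exists [:: x] => y /= <-; exists x; rewrite ?inE //; split; apply: can_refl.
have /choice[f fP] := link_cover; exists (flatten (map f s)).
move=> y xy; have [z /sP[u us zu] zy] := walkSr xy.
have [v vf yv] := fP u y (link_sym (link_clus (link_sym zy) zu)).
by exists v => //; apply/flatten_mapP; exists u.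
Qed.

(** Were a cluster reached in [k.+1] steps but not in [k], a formula defining the clusters not
    reached in [k] would refute an instance of the hypothesis at [x]. So walks of length [k] reach
    every cluster of the component. *)
Lemma component_cover k x :
  L (Imp (iter k.+1 step (Var 0)) (iter k step (Var 0))) ->
  exists s, forall n y, walk (@can L) n x y -> around s y.
Proof.
move=> Lk; have [s sP] := walk_cover k x; have [t tP] := walk_cover k.+1 x.
pose near y := exists2 u, walk (@can L) k x u & clus (@can L) u y.
have kS y : walk (@can L) k.+1 x y -> near y.
  move=> xy; apply: contrapT => ny.
  have [|p pP] := @clus_definable t (~` near).
    move=> u v uv nu [w xw wv]; apply: nu; exists w => //.
    by apply: clus_trans wv (clus_sym uv); exact: narrow_can.
  have := holds_subst x (fun=> p) Lk.
  rewrite /= (holdsI tL) !subst_iter_step /= => h.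
  have [|z xz zp] := (holds_iter_step tL k x p).1.
  - apply: h; apply/(holds_iter_step tL k.+1); exists y => //.
    exact/pP/ny/tP.
  - have xz' : walk (@can L) k.+1 x z by apply: walk_leq xz => //; apply: can_refl.
    have /(pP _ (tP _ xz')) : z p by [].
    by case; exists z => //; split; apply: can_refl.
exists s => n y xy; suff [u /sP[v vs uv] uy] : near y.
  by exists v => //; apply: clus_trans (clus_sym uy) uv; exact: narrow_can.
elim: n y xy => [|n IH] y.
  move=> /= <-; exists x; [apply: walk_refl; exact: can_refl|split; exact: can_refl].
move=> xy; have [z /IH[u xu uz] zy] := walkSr xy; apply: kS.
rewrite -addn1; apply: walk_cat xu _; apply: walk1.
exact: link_sym (link_clus (link_sym zy) (clus_sym uz)).
Qed.

End Definability.

(** * Logics of bounded diameter *)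

Fixpoint bound p :=
  match p with
  | Var n => n.+1
  | Bot => 0
  | Imp p q => maxn (bound p) (bound q)
  | Box p | Past p => bound p
  end.

Fixpoint depth p :=
  match p with
  | Var _ | Bot => 0
  | Imp p q => maxn (depth p) (depth q)
  | Box p | Past p => (depth p).+1
  end.

(* [Z d] relates points whose neighbourhoods of radius [d] look alike. *)
Lemma bisim_truth (L : set form) (tL : tense_logic L) (F : frame)
    (V : nat -> set F) (s : nat -> form) (N : nat)
    (Z : nat -> ultra L -> F -> Prop) :
  (forall d w f, Z d.+1 w f -> Z d w f) ->
  (forall d w f n, n < N -> Z d w f -> (w (s n) <-> V n f)) ->
  (forall d w w' f, Z d.+1 w f -> can w w' -> exists2 f', acc f f' & Z d w' f') ->
  (forall d w f f', Z d.+1 w f -> acc f f' -> exists2 w', can w w' & Z d w' f') ->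
  (forall d w w' f, Z d.+1 w f -> can w' w -> exists2 f', acc f' f & Z d w' f') ->
  (forall d w f f', Z d.+1 w f -> acc f' f -> exists2 w', can w' w & Z d w' f') ->
  forall p w f, bound p <= N -> Z (depth p) w f -> (w (subst s p) <-> sat V f p).
Proof.
move=> Zanti atom forth back forth' back'.
have Zle d e w f : d <= e -> Z e w f -> Z d w f.
  elim: e => [|e IH]; first by rewrite leqn0 => /eqP ->.
  by rewrite leq_eqVlt => /orP[/eqP -> //|/IH h] /Zanti.
elim=> [n||p IHp q IHq|p IH|p IH] w f /=.
- by move=> nN; apply: atom.
- by rewrite holdsB.
- rewrite geq_max => /andP[pN qN] Zwf; rewrite (holdsI tL).
  rewrite (IHp w f pN) ?(IHq w f qN) //; first exact: Zle _ _ _ _ (leq_maxr _ _) Zwf.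
  exact: Zle _ _ _ _ (leq_maxl _ _) Zwf.
- move=> pN Zwf; rewrite (holds_Box tL); split=> h.
    by move=> f' /(back _ _ _ _ Zwf)[w' ww' Z']; apply/(IH w') => //; apply: h.
  by move=> w' /(forth _ _ _ _ Zwf)[f' ff' Z']; apply/(IH w' f') => //; apply: h.
- move=> pN Zwf; rewrite (holds_Past tL); split=> [[w' ww' h]|[f' ff' h]].
    have [f' ff' Z'] := forth' _ _ _ _ Zwf ww'.
    by exists f' => //; apply/(IH w').
  have [w' ww' Z'] := back' _ _ _ _ Zwf ff'.
  by exists w' => //; apply/(IH w' f').
Qed.

(** * Boolean operations on definable sets *)

Section Definable.
Variables (L : set form) (tL : tense_logic L).

Lemma definableI (D A B : set (ultra L)) :
  definable D A -> definable D B -> definable D (A `&` B).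
Proof.
move=> [p pA] [q qB]; exists (And p q) => z Dz.
by rewrite (holdsA tL) (pA z Dz) (qB z Dz).
Qed.

Lemma definableC (D A : set (ultra L)) : definable D A -> definable D (~` A).
Proof. by move=> [p pA]; exists (Neg p) => z Dz; rewrite holdsN (pA z Dz). Qed.

Lemma definable_bigcup (I : finType) (D : set (ultra L)) (P : set I)
    (A : I -> set (ultra L)) :
  (forall i, definable D (A i)) -> definable D (\bigcup_(i in P) A i).
Proof.
move=> /choice[p pA]; exists (\big[Or/Bot]_(i <- enum I | `[<P i>]) p i) => z Dz.
rewrite (holds_bigOr tL); split=> [[i [_ /asboolP Pi /(pA i z Dz)]]|[i Pi]].
  by exists i.
by move=> /(pA i z Dz) zi; exists i; rewrite mem_enum; split=> //; apply/asboolP.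
Qed.

Lemma definable_bigcap (I : finType) (D : set (ultra L)) (A : I -> set (ultra L)) :
  (forall i, definable D (A i)) -> definable D [set z | forall i, A i z].
Proof.
move=> hA; rewrite [X in definable D X](_ : _ = ~` \bigcup_(i in setT) ~` A i).
  by apply/definableC/definable_bigcup => i; apply/definableC.
apply/seteqP; split=> [z h [i _]|z h i]; first by apply.
by apply: contrapT => ni; apply: h; exists i.
Qed.

End Definable.

Lemma finite_sig (P : pred nat) n :
  (forall i, P i -> i < n) -> finite_set [set: {i : nat | P i}].
Proof.
move=> Pn; have [[a _]|n0] := pselect ([set: {i : nat | P i}] !=set0); last first.
  by rewrite (_ : setT = set0) //; apply/seteqP; split=> // a _; apply: n0; exists a.
apply: (@sub_finite_set _ _ [set insubd a i | i in `I_n]).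
  by move=> b _; exists (val b); [apply/Pn/(valP b)|rewrite valKd].
exact/finite_image/finite_II.
Qed.

(** * The finite quotient of a component *)

Section BoundedDiameter.
Variables (L : set form) (tL : tense_logic L) (hext : S4BP2w22 `<=` L).

(** All classes of the quotient are definable on the component, so any valuation on it comes from a
    substitution; closure of [L] under substitution then makes [L] valid there. *)
Lemma finite_refutation k phi :
  L (Imp (iter k.+1 step (Var 0)) (iter k step (Var 0))) -> ~ L phi ->
  exists F, [/\ finite_frame F, forall p, L p -> valid F p & ~ valid F phi].
Proof.
move=> Lk nphi.
have [x xphi] : exists x : ultra L, ~ x phi.
  apply: contrapT => n; apply/nphi/(ultra_complete tL) => x.
  by apply: contrapT => xp; apply: n; exists x.
have [s sP] := component_cover tL hext x Lk.
pose D := [set y | exists n, walk (@can L) n x y].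
have Dx : D x by exists 0.
have Ds : D `<=` around s by move=> y [n /sP].
have Dlink y z : D y -> link (@can L) y z -> D z.
  by move=> [n xy] yz; exists (n + 1); apply: walk_cat xy (walk1 yz).
pose N := bound phi.
(* Clusters are numbered by their first listed member; points outside the list get [size s], whence
   the successor in the ordinal type of [key0]. *)
pose pos y := find (fun a => `[<clus (@can L) a y>]) s.
have nR := narrow_can tL hext.
have posP y z : D y -> (pos y = pos z <-> clus (@can L) y z).
  move=> /Ds[a sa ya]; split=> [e|yz]; last first.
    apply: eq_find => b; apply/asboolP/asboolP => h; first by apply: (clus_trans nR h).
    by apply: (clus_trans nR h); apply: clus_sym.
  have cpos u : has (fun a => `[<clus (@can L) a u>]) s -> clus (@can L) (nth x s (pos u)) u.
    by move=> /(nth_find x) /asboolP.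
  have hy : has (fun a => `[<clus (@can L) a y>]) s.
    by apply/hasP; exists a; [exact: sa|exact: asboolT (clus_sym ya)].
  have cz := cpos z; rewrite -e in cz.
  apply: (clus_trans nR (clus_sym (cpos y hy))); apply: cz.
  by move: hy e; rewrite /pos !has_find => hy <-.
have pos_size y : pos y <= size s by rewrite find_size.
pose key0 y : 'I_(size s).+1 * {ffun 'I_N -> bool} :=
  (inord (pos y), [ffun n : 'I_N => `[<y (Var n)>]]).
have key0P y z : D y -> D z -> (key0 y = key0 z <->
    clus (@can L) y z /\ forall n : 'I_N, y (Var n) <-> z (Var n)).
  move=> Dy Dz; rewrite -(posP y z Dy) /key0; split=> [[/(congr1 val) /=]|[-> h]].
    rewrite !inordK ?ltnS ?pos_size // => -> /ffunP h; split=> // n.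
    have := h n; rewrite !ffunE => e.
    by split=> /asboolP hn; apply/asboolP; [rewrite -e|rewrite e].
  by congr pair; apply/ffunP => n; rewrite !ffunE; apply: asbool_equiv_eq.
have key0D t : definable D [set y | key0 y = t].
  case: (pselect (exists2 z, D z & key0 z = t)) => [[z Dz <-]|nz]; last first.
    by exists Bot => y Dy; rewrite holdsB; split=> // e; apply: nz; exists y.
  have [p pP] : definable D ([set y | clus (@can L) y z] `&`
      [set y | forall n : 'I_N, y (Var n) <-> z (Var n)]).
    apply: definableI => //.
      have [|p pP] := @clus_definable _ tL hext s [set y | clus (@can L) y z].
        by move=> u v uv uz; exact: (clus_trans nR (clus_sym uv)).
      by exists p => y /Ds/pP.
    apply: definable_bigcap => // n; have [zn|zn] := pselect (z (Var n)).
      by exists (Var n) => y _; split=> // h; apply/h.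
    by exists (Neg (Var n)) => y _; rewrite holdsN; split=> [//|h /h].
  by exists p => y Dy; rewrite (pP y Dy) /= (key0P y z Dy Dz).
(* The worlds are coded as numbers: ['I_n] lives in too high a universe. *)
pose key y : nat := enum_rank (key0 y).
have keyP y z : D y -> D z -> key y = key z -> clus (@can L) y z /\
    forall n : 'I_N, y (Var n) <-> z (Var n).
  by move=> Dy Dz /val_inj/enum_rank_inj/key0P; apply.
pose W := {t : nat | `[<exists2 y, D y & key y = t>]}.
have kW y : D y -> `[<exists2 z, D z & key z = key y>].
  by move=> Dy; apply/asboolP; exists y.
(* One pair of representatives suffices: members of a class share a cluster, hence have the same
   successors and predecessors. *)
pose A (f g : W) := exists y z, [/\ D y, D z, key y = val f, key z = val g & can y z].
pose toW y (Dy : D y) : W := exist _ (key y) (kW y Dy).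
have W0 : [set: W] !=set0 by exists (toW x Dx).
pose F := @Frame W A W0.
have WP (f : W) : exists2 y, D y & key y = val f by case: f => t /= /asboolP.
pose Z (d : nat) (w : ultra L) (f : F) := D w /\ key w = val f.
have truth (V : nat -> set F) (t : nat -> form) M :
    (forall w f n, n < M -> D w -> key w = val f -> (w (t n) <-> V n f)) ->
    forall p w f, bound p <= M -> D w -> key w = val f -> (w (subst t p) <-> sat V f p).
  move=> atom p w f pM Dw kw.
  apply: (@bisim_truth L tL F V t M Z) => //.
  - by move=> d u g n nM [Du ku]; apply: atom.
  - move=> d u v g [Du ku] uv; have Dv : D v by apply: Dlink Du _; left.
    by exists (toW v Dv) => //; exists u, v.
  - move=> d u g h [Du ku] [u' [v [Du' Dv ku' kv uv]]]; exists v => //.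
    have /keyP[//|//|[uu' _] _] : key u = key u' by rewrite ku ku'.
    exact: ntrans nR _ _ _ uu' uv.
  - move=> d u v g [Du ku] uv; have Dv : D v by apply: Dlink Du _; right.
    by exists (toW v Dv) => //; exists v, u.
  - move=> d u g h [Du ku] [v [u' [Dv Du' kv ku' uv]]]; exists v => //.
    have /keyP[//|//|[_ uu'] _] : key u = key u' by rewrite ku ku'.
    exact: ntrans nR _ _ _ uv uu'.
exists F; split; first apply: finite_sig => t /asboolP[y _ <-].
  exact: ltn_ord.
  move=> p Lp V f; have [w Dw kw] := WP f.
  (* A set of worlds is a finite union of classes, so a formula defines its preimage in [D]. *)
  have /choice[t tP] : forall n, definable D [set y | exists2 g, V n g & key y = val g].
    move=> n; have [|q qP] := @definable_bigcup L tL _ D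
      [set t | exists2 g, V n g & enum_rank t = val g :> nat]
      (fun t => [set y | key0 y = t]); first exact: key0D.
    exists q => y /qP ->; split=> [[t [g Vg tg] /= yt]|[g Vg kg]].
      by exists g; rewrite // /key yt.
    by exists (key0 y) => //; exists g.
  apply/(truth V t (bound p) _ p w f) => //; last exact: holds_subst.
  move=> u g n _ Du ku; rewrite (tP n u Du); split=> [[h Vh]|Vg]; last by exists g.
  by rewrite ku => /val_inj ->.
pose V0 n : set F := [set f | exists2 y, D y /\ key y = val f & y (Var n)].
have idE p : subst Var p = p by elim: p => //= [p -> q ->|p ->|p ->].
move=> /(_ V0 (toW x Dx)) h; apply: xphi; rewrite -(idE phi).
apply/(truth V0 Var N _ phi x (toW x Dx)) => //.
move=> w f n nN Dw kw; split=> [wn|[y [Dy ky] yn]]; first by exists w.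
have /keyP[//|//|_ /(_ (Ordinal nN)) h'] : key w = key y by rewrite kw ky.
exact/h'.
Qed.

End BoundedDiameter.

(** * Logics of unbounded diameter *)

Lemma finite_uniform_bound (T : Type) (P : T -> nat -> Prop) :
  finite_set [set: T] -> (forall x m n, m <= n -> P x m -> P x n) ->
  (forall x, exists n, P x n) -> exists n, forall x, P x n.
Proof.
move=> finT Pmono; move=> /choice[f fP].
have /finite_seqP[s sT] : finite_set [set: {classic T}] by [].
exists (\max_(x <- s) f x) => x; apply: Pmono (fP x).
by apply: leq_bigmax_seq => //; have : [set` s] (x : {classic T}) by rewrite -sT.
Qed.

(* The fence 0 < 1 > 2 < 3 > ... *)
Definition zig a b := a = b \/ ~~ odd a /\ (b = a.+1 \/ a = b.+1).

(** * Fences closed into cycles *)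

Section Cycle.
Variable n : nat.
Let m := n.*2.+2.

Definition cycle_world := {i : nat | i < m}.

(** Even worlds see both neighbours; as [m] is even, parity survives reduction modulo [m]. For
    [n = 0] the neighbours coincide and the frame is a two-element chain. *)
Definition cycle_acc (f g : cycle_world) := val f = val g \/
  ~~ odd (val f) /\ (val g = (val f).+1 %% m \/ val f = (val g).+1 %% m).

Definition cycle_proj j : cycle_world := exist _ (j %% m) (ltn_pmod j (ltn0Sn _)).

Lemma cycle_world_nonempty : [set: cycle_world] !=set0.
Proof. by exists (cycle_proj 0). Qed.

Definition cycle := @Frame cycle_world cycle_acc cycle_world_nonempty.

Lemma cycle_projK (g : cycle_world) : cycle_proj (val g) = g.
Proof. by apply: val_inj; rewrite /= modn_small // (valP g). Qed.

Lemma odd_cycle_proj j : odd (val (cycle_proj j)) = odd j.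
Proof. by rewrite /= odd_mod // /m /= negbK odd_double. Qed.

Lemma modSmod j : (j %% m).+1 %% m = j.+1 %% m.
Proof. by rewrite -addn1 modnDml addn1. Qed.

Lemma zig_cycle_acc a b : zig a b -> cycle_acc (cycle_proj a) (cycle_proj b).
Proof.
case=> [->|[oa [->|e]]]; first by left.
  by right; rewrite odd_cycle_proj oa; split=> //; left; rewrite /= modSmod.
by right; rewrite odd_cycle_proj oa; split=> //; right; rewrite e /= modSmod.
Qed.

Lemma cycle_proj_pred a g : 0 < a -> val (cycle_proj a) = (val g).+1 %% m -> cycle_proj a.-1 = g.
Proof.
move=> a0 /eqP; rewrite /= -{1}(prednK a0) -addn1 -[(val g).+1]addn1 eqn_modDr => /eqP e.
by rewrite -[RHS]cycle_projK; apply: val_inj.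
Qed.

(** Back condition for the projection of the fence onto the cycle; position [0] is excluded, having
    no left neighbour on the fence. *)
Lemma cycle_acc_zig a g : 0 < a -> cycle_acc (cycle_proj a) g -> exists2 b, zig a b & cycle_proj b = g.
Proof.
move=> a0 [e|[]]; first by exists a; [left|apply: val_inj].
rewrite odd_cycle_proj => oa [e|/(cycle_proj_pred a0) <-].
  by exists a.+1; [right; split=> //; left|apply: val_inj; rewrite e /= modSmod].
by exists a.-1 => //; right; split=> //; right; rewrite prednK.
Qed.

Lemma cycle_acc_zig' a g : 0 < a -> cycle_acc g (cycle_proj a) -> exists2 b, zig b a & cycle_proj b = g.
Proof.
move=> a0 [e|[og [|e]]]; first by exists a; [left|apply: val_inj].
  move=> /(cycle_proj_pred a0) e; exists a.-1 => //; right.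
  by rewrite -odd_cycle_proj e og; split=> //; left; rewrite prednK.
have {}e : cycle_proj a.+1 = g by apply: val_inj; rewrite e /= modSmod.
by exists a.+1 => //; right; rewrite -odd_cycle_proj e; split=> //; right.
Qed.

(** The alternatives are the two ways round the cycle. *)
Lemma cycle_walk k g : walk cycle_acc k (cycle_proj 0) g -> val g <= k \/ m <= val g + k.
Proof.
elim: k g => [|k IH] g; first by move=> <-; left; rewrite /= mod0n.
have mS i : i < m -> i.+1 %% m = if i.+1 == m then 0 else i.+1.
  move=> im; case: eqP => [->|ne]; first by rewrite modnn.
  by rewrite modn_small // ltn_neqAle im andbT; apply/eqP.
move=> w; have [h /IH IHh hg] := walkSr w.
have hm := valP h; have gm := valP g.
case: hg => -[e|[_ []]]; rewrite ?mS // ?e; try lia.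
all: case: eqP; lia.
Qed.

End Cycle.

Lemma finite_cycle n : finite_frame (cycle n).
Proof. by apply: (@finite_sig (fun i => i < n.*2.+2) n.*2.+2). Qed.

Definition cycles : set frame := [set F | exists n, F = cycle n].

Lemma sat_Imp (F : frame) (V : nat -> set F) x p q :
  sat V x (Imp p q) <-> (sat V x p -> sat V x q).
Proof. by []. Qed.

(** Distances between connected points have a common bound by finiteness, and shorter walks are
    padded by reflexivity. *)
Lemma finite_frame_step (F : frame) : finite_frame F -> (forall x : F, acc x x) ->
  exists k, valid F (Imp (iter k.+1 step (Var 0)) (iter k step (Var 0))).
Proof.
move=> finF Frefl.
pose P (x y : F) k := (exists l, walk (@acc F) l x y) -> walk (@acc F) k x y.
have Pmono x y k l : k <= l -> P x y k -> P x y l.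
  by move=> kl h /h; apply: walk_leq kl.
have [k kP] : exists k, forall x y, P x y k.
  apply: (@finite_uniform_bound F (fun x k => forall y, P x y k)) => //.
    by move=> x k l kl h y; apply: Pmono kl (h y).
  move=> x; apply: (@finite_uniform_bound F (fun y k => P x y k)) => // [y|y].
    exact: Pmono.
  have [[l w]|nw] := pselect (exists l, walk (@acc F) l x y); first by exists l.
  by exists 0.
exists k => V x; apply/sat_Imp; rewrite !sat_iter_step => -[y w yV]; exists y => //.
by apply: kP; exists k.+1.
Qed.

Lemma cycle_acc_refl n (f : cycle_world n) : cycle_acc f f.
Proof. by left. Qed.

Lemma cycles_step k :
  ~ Log cycles (Imp (iter k.+1 step (Var 0)) (iter k step (Var 0))).
Proof.
(* This cycle has [2k + 4] worlds, so world [k.+1] is more than [k] steps from [0] either way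
   round. *)
move=> h; pose F := cycle k.+1; pose p i : F := cycle_proj k.+1 i.
have := h F (ex_intro _ k.+1 erefl).
pose V (n : nat) := [set p k.+1].
move=> /(_ V (p 0)) /sat_Imp; rewrite !sat_iter_step => -[|y w].
  exists (p k.+1) => //.
  rewrite -[X in p X]add0n; apply: (@path_walk F (@acc F)) => j _.
  case: (boolP (odd j)) => oj.
    by right; apply: zig_cycle_acc; right; rewrite /= oj; split=> //; right.
  by left; apply: zig_cycle_acc; right; split=> //; left.
move=> /= yE; have := cycle_walk w.
by rewrite yE /= modn_small; lia.
Qed.

(** A finite frame with this logic would be reflexive, as all cycles are, and so would validate a
    formula excluded by [cycles_step]. *)
Lemma cycles_not_tabular : ~ tabular (Log cycles).
Proof.
move=> [F finF e]; have Frefl (x : F) : acc x x.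
  have : Log cycles (Imp (Box (Var 0)) (Var 0)).
    by move=> _ [n ->] V f h; apply: h; apply: cycle_acc_refl.
  by rewrite e => /(_ F erefl (fun=> [set y | acc x y]) x); apply.
have [k kF] := finite_frame_step finF Frefl.
by apply: (@cycles_step k); rewrite e => _ ->.
Qed.

(** * Geodesics in preorders of depth and width two *)

Section Geodesic.
Variables (T : Type) (R : T -> T -> Prop).
Hypotheses (Rup : narrow R) (Rdown : narrow (fun x y => R y x)).

(** Inside a geodesic the clusters are distinct, so depth two makes the steps alternate, and width
    two leaves no neighbouring clusters other than those on the geodesic. *)
Lemma geodesic_zigzag M x z :
  walk R M.+3 x z -> ~ walk R M.+2 x z ->
  exists y : nat -> T,
  [/\ forall i j, i <= M -> j <= M -> clus R (y i) (y j) -> i = j,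
      forall i j, i <= M -> j <= M -> zig i j -> R (y i) (y j),
      forall j z, 0 < j < M -> R (y j) z -> exists2 b, zig j b & clus R z (y b) &
      forall j z, 0 < j < M -> R z (y j) -> exists2 b, zig b j & clus R z (y b)].
Proof.
move=> w0; have [f [f0 fM fE]] := walk_path w0; rewrite -f0 -fM => nw.
have geo i j n : i <= j <= M.+3 -> walk R n (f i) (f j) -> j - i <= n.
  move=> /andP[ij jM] w; rewrite leqNgt; apply/negP => nij; apply: nw.
  have w1 : walk R i (f 0) (f i).
    by rewrite -{2}[i]add0n; apply: path_walk => k /andP[_ ki]; apply: fE; lia.
  have w2 : walk R (M.+3 - j) (f j) (f M.+3).
    rewrite -{2}(subnKC jM); apply: path_walk => k; rewrite subnKC // => /andP[_ kM].
    exact: fE.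
  apply: (walk_leq (nrefl Rup)) (walk_cat (walk_cat w1 w) w2); lia.
(* [f i.-1] is linked to the whole cluster of [f i], which would bring [f j] too close. Index [0]
   has no such predecessor: its cluster may contain [f 1]. *)
have ninj i j : 0 < i -> i < j -> j <= M.+3 -> ~ clus R (f i) (f j).
  move=> i0 ij jM c; have : j - i.-1 <= 1; last by lia.
  apply: geo; first by lia.
  have li : link R (f i.-1) (f i) by rewrite -{2}(prednK i0); apply: fE; lia.
  apply: walk1; case: c li => ab ba [h|h]; [left; exact: ntrans Rup _ _ _ h ab|].
  by right; exact: ntrans Rup _ _ _ ba h.
pose up i := R (f i) (f i.+1).
have dn i : i < M.+3 -> ~ up i -> R (f i.+1) (f i) by move=> /fE[].
have alt i : 0 < i -> i.+1 < M.+3 -> (up i.+1 <-> ~ up i).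
  move=> i0 iM; have ci := ninj i i.+1 i0 (ltnSn _) (ltnW iM).
  have cSi := ninj i.+1 i.+2 isT (ltnSn _) iM.
  split=> [u2 u1|u1]; first by have [h|h] := ndepth Rup u1 u2; [apply: ci|apply: cSi].
  apply: contrapT => u2; have d1 := dn i (ltnW iM) u1; have d2 := dn _ iM u2.
  by have [h|h] := ndepth Rup d2 d1; [apply: cSi|apply: ci].
(* The fence must start at a bottom point, which costs a shift by [1] or [2]; the length [M.+3]
   leaves room for it. *)
have [o [o0 o2 uo]] : exists o, [/\ 0 < o, o <= 2 & up o].
  have [u1|u1] := pselect (up 1); first by exists 1.
  by exists 2; split=> //; apply/alt.
have par j : j <= M -> (up (o + j) <-> ~~ odd j).
  elim: j => [|j IH] jM; first by rewrite addn0.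
  have e := IH (ltnW jM); have a := alt (o + j); rewrite addnS /=.
  rewrite a; [|lia|lia]; rewrite e; by split=> /negP.
pose y j := f (o + j).
have yinj i j : i <= M -> j <= M -> clus R (y i) (y j) -> i = j.
  move=> iM jM c; have [ij|ji|//] := ltngtP i j.
    by case: (ninj (o + i) (o + j) _ _ _ c); lia.
  by case: (ninj (o + j) (o + i) _ _ _ (clus_sym c)); lia.
have yR i j : i <= M -> j <= M -> zig i j -> R (y i) (y j).
  move=> iM jM [->|[oi [e|e]]]; first exact: nrefl Rup _.
    by rewrite e /y addnS; apply/par.
  move: oi; rewrite e /y addnS /= negbK => oj.
  by apply: dn; [lia|move=> /(par _ jM); rewrite oj].
have nb i j : i <= M -> j <= M -> i <> j -> zig i j -> R (y i) (y j) /\ ~ R (y j) (y i).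
  move=> iM jM ij h; have r := yR _ _ iM jM h; split=> // r'; apply: ij.
  exact: yinj.
(* By depth, tops are maximal and bottoms minimal; in the other direction the two neighbours on the
   path exhaust the width. *)
exists y; split=> // j u /andP[j0 jM].
  have [oj|oj] := boolP (odd j).
    have [||||r nr] := nb j.+1 j; try lia.
      by right; rewrite /= negbK; split=> //; right.
    move=> ju; exists j; first by left.
    by have := narrow_down Rdown r nr ju; case.
  have [||||r nr] := nb j j.+1; try lia.
    by right; split=> //; left.
  have [||||r' nr'] := nb j j.-1; try lia.
    by right; split=> //; right; lia.
  have ny : ~ clus R (y j.+1) (y j.-1) by move=> /yinj; lia.
  move=> /(narrow_up Rup r nr r' nr' ny)[c|[c|c]]; [exists j|exists j.+1|exists j.-1] => //.
  - by left.
  - by right; split=> //; left.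
  - by right; split=> //; right; lia.
have [oj|oj] := boolP (odd j); last first.
  have [||||r nr] := nb j j.+1; try lia.
    by right; split=> //; left.
  move=> ju; exists j; first by left.
  exact: (narrow_down Rup r nr ju).
have [||||r nr] := nb j.+1 j; try lia.
  by right; rewrite /= negbK; split=> //; right.
have [||||r' nr'] := nb j.-1 j; try lia.
  by right; split; [lia|left; lia].
have ny : ~ clus (fun a b => R b a) (y j.+1) (y j.-1).
  by move=> [c c']; have := yinj j.+1 j.-1; move=> /(_ _ _ (conj c' c)); lia.
move=> /(narrow_up Rdown r nr r' nr' ny)[[c c']|[[c c']|[c c']]].
- by exists j; [left|].
- by exists j.+1; [right; rewrite /= negbK; split=> //; right|].
- by exists j.-1; [right; split; [lia|left; lia]|].
Qed.

End Geodesic.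

Section UnboundedDiameter.
Variables (L : set form) (tL : tense_logic L) (hext : S4BP2w22 `<=` L).
Hypothesis nL : forall k, ~ L (Imp (iter k.+1 step (Var 0)) (iter k step (Var 0))).

(** A valuation on the cycle is pulled back to a long geodesic, where definability turns it into a
    substitution; a bisimulation up to the modal depth of [p] transfers truth. *)
Lemma sub_Log_cycles : L `<=` Log cycles.
Proof.
move=> p Lp _ [n ->] V g0.
(* [j0] projects to [g0], and both [j0] and [M - j0] exceed the modal depth of [p]. *)
pose D := depth p; pose j0 := val g0 + n.*2.+2 * D.+1; pose M := j0 + D.+1.
have [x xk] : exists x : ultra L,
    ~ x (Imp (iter M.+3 step (Var 0)) (iter M.+2 step (Var 0))).
  apply: contrapT => nx; apply: (@nL M.+2); apply/(ultra_complete tL) => x.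
  by apply: contrapT => h; apply: nx; exists x.
move: xk; rewrite (holdsI tL) => /not_implyP[/(holds_iter_step tL)[z xz z0] nxz].
have [|y [yinj yR yup ydown]] :=
    geodesic_zigzag (narrow_can tL hext) (narrow_nac tL hext) xz.
  by move=> xz'; apply: nxz; apply/(holds_iter_step tL); exists z.
(* The margin [e] keeps the next [e] steps away from both ends, where the shape of the geodesic is
   not controlled. *)
pose Z e (w : ultra L) (g : cycle_world n) :=
  exists j, [/\ e < j, j + e < M, clus (@can L) w (y j) & cycle_proj n j = g].
have /choice[t tP] : forall i, definable (around [seq y k | k <- iota 0 M.+1])
    [set w | exists j, [/\ j <= M, clus (@can L) w (y j) & V i (cycle_proj n j)]].
  move=> i; apply: clus_definable => // u v uv [j [jM uj Vj]].
  by exists j; split=> //; apply: (clus_trans (narrow_can tL hext) (clus_sym uv)).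
have ct := can_trans tL hext.
have crefl w : clus (@can L) w w by split; apply: (nrefl (narrow_can tL hext)).
have zle a b : zig a b -> a <= b.+1 /\ b <= a.+1 by case=> [->|[_ [->|->]]]; lia.
apply/(@bisim_truth L tL (cycle n) V t (bound p) Z _ _ _ _ _ _ p (y j0) g0) => //.
- by move=> e w g [j [ej jM wj jg]]; exists j; split=> //; lia.
- move=> e w g i iN [j [ej jM wj jg]]; rewrite (tP i w); last first.
    by exists (y j) => //; apply: map_f; rewrite mem_iota; lia.
  split=> [[k [kM wk]]|Vg]; last by exists j; rewrite jg; split=> //; lia.
  rewrite -jg (yinj j k) //; first by lia.
  exact: (clus_trans (narrow_can tL hext) (clus_sym wj) wk).
- move=> e w w' g [j [ej jM [wj jw] <-]] ww'.
  have [|b /[dup] jb /zle[]] := yup j w' _ (ct _ _ _ jw ww'); first by lia.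
  by move=> ? ? w'b; exists (cycle_proj n b); [exact: zig_cycle_acc|exists b; split=> //; lia].
- move=> e w g g' [j [ej jM [wj jw] <-]] /cycle_acc_zig[|b jb bg']; first by lia.
  have [? ?] := zle _ _ jb; exists (y b); last by exists b; split=> //; lia.
  by apply: ct wj (yR j b _ _ jb); lia.
- move=> e w w' g [j [ej jM [wj jw] <-]] w'w.
  have [|b /[dup] jb /zle[]] := ydown j w' _ (ct _ _ _ w'w wj); first by lia.
  by move=> ? ? w'b; exists (cycle_proj n b); [exact: zig_cycle_acc|exists b; split=> //; lia].
- move=> e w g g' [j [ej jM [wj jw] <-]] /cycle_acc_zig'[|b jb bg']; first by lia.
  have [? ?] := zle _ _ jb; exists (y b); last by exists b; split=> //; lia.
  by apply: ct (yR b j _ _ jb) jw; lia.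
- exists j0; split=> //; [rewrite /j0; nia|rewrite /M /D; lia|].
  by apply: val_inj; rewrite /= /j0 addnC mulnC modnMDl modn_small // (valP g0).
exact: holds_subst.
Qed.
End UnboundedDiameter.

(** * The dichotomy between bounded and unbounded diameter *)

Theorem theorem7p15 (L : set form) (hL : pretabular L) (hext : S4BP2w22 `<=` L) :
  fmp L.
Proof.
have [tL _ ext] := hL.
have [[k Lk]|nL] := pselect (exists k,
    L (Imp (iter k.+1 step (Var 0)) (iter k step (Var 0)))).
  exists [set F | finite_frame F /\ forall p, L p -> valid F p]; first by move=> F [].
  apply/seteqP; split=> [p Lp F [_]|p h]; first exact.
  apply: contrapT => np; have [F [finF LF]] := finite_refutation tL hext Lk np.
  by apply; apply: h.
exists cycles; first by move=> _ [n ->]; apply: finite_cycle.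
have LC : L `<=` Log cycles by apply: sub_Log_cycles => // k Lk; apply: nL; exists k.
apply/seteqP; split=> //; apply: contrapT => CL.
apply: cycles_not_tabular; apply: ext; first exact: tense_logic_Log.
  by split.
by move=> h; apply: (h (cycle 0) _ (fun=> setT) (cycle_proj 0 0)); exists 0.
Qed.
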